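(* For every odd integer $n \ge 4$ and every integer $\lambda \in \left\{-3,\ldots,\frac{n-11}{2}\right\} \cup \left\{\frac{n-5}{2},\ldots,n-4\right\}$ (each set being an interval of consecutive integers), the vector $E_{n,\lambda} = P_{n,\lambda}+Q_{n,\lambda}$, with $P_{n,\lambda}$ and $Q_{n,\lambda}$ as defined in the context, is an eigenvector (in particular nonzero) of the adjacency matrix of the $n$-Queens graph $\mathcal{Q}(n)$ associated with the eigenvalue $\lambda$.
   Context: Write $[n] = \{1,\dots,n\}$. The $n$-Queens graph $\mathcal{Q}(n)$ is the simple graph whose vertices are the $n^2$ squares $(i,j) \in [n]^2$ of an $n\times n$ chessboard ($i$ is the row, $j$ is the column), two distinct vertices being adjacent if and only if they lie in the same row, the same column, or the same diagonal; that is, distinct $(i,j)$ and $(p,q)$ are adjacent iff $i=p$, or $j=q$, or $i+j=p+q$, or $i-j=p-q$. Eigenvalues and eigenvectors of $\mathcal{Q}(n)$ are those of its adjacency matrix, which acts on vectors $v = (v_{(i,j)})_{(i,j)\in[n]^2}$ with real coordinates indexed by the squares. For $i,j\in[n]$ let $i \ominus j = |i-j|$ and $i \oplus j = |i+j-(n+1)|$. For $n\ge 4$ odd and $\lambda\in\mathbb{Z}$ with $1\le\lambda+4\le n$, let $k = (\lambda+4) - \frac{n-1}{2}$, and define vectors $P_{n,\lambda}, Q_{n,\lambda}$ (with coordinates indexed by $[n]^2$) by: - $(P_{n,\lambda})_{(i,j)} = k$ if $i\ominus j = n-(\lambda+4)$; $(P_{n,\lambda})_{(i,j)} = 1$ if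 $i\ominus j < n-(\lambda+4)$, $i\oplus j < \lambda+4$, and $i\ominus j \equiv n-(\lambda+4) \pmod 2$; and $(P_{n,\lambda})_{(i,j)} = 0$ otherwise. - $(Q_{n,\lambda})_{(i,j)} = -k$ if $i\oplus j = n-(\lambda+4)$; $(Q_{n,\lambda})_{(i,j)} = -1$ if $i\oplus j < n-(\lambda+4)$, $i\ominus j < \lambda+4$, and $i\oplus j \equiv n-(\lambda+4) \pmod 2$; and $(Q_{n,\lambda})_{(i,j)} = 0$ otherwise. *)

(* Defs.v *)
From mathcomp Require Import all_boot all_order all_algebra.

Set Implicit Arguments.
Unset Strict Implicit.
Unset Printing Implicit Defensive.

Import Order.TTheory GRing.Theory Num.Theory.
Local Open Scope ring_scope.

Definition adjacency_mx (R : nzRingType) (T : finType) (e : rel T) : 'M[R]_#|T| :=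
  \matrix_(a, b) (e (enum_val a) (enum_val b))%:R.

Definition vec_of (R : nzRingType) (T : finType) (f : T -> R) : 'cV[R]_#|T| :=
  \col_a f (enum_val a).

(* MathComp's [eigenspace] acts on row vectors; this is the column version. *)
Definition is_eigenvector (R : nzRingType) (m : nat) (A : 'M[R]_m) (a : R)
    (v : 'cV[R]_m) : Prop :=
  v != 0 /\ A *m v = a *: v.

Definition square (n : nat) : finType := ('I_n * 'I_n)%type.

(* Ordinals count from 0: [sqrow] and [sqcol] are the coordinates in {1, .., n},
   taken in [int] so that the differences below are not truncated. *)
Definition sqrow (n : nat) (s : square n) : int := (s.1).+1%:Z.
Definition sqcol (n : nat) (s : square n) : int := (s.2).+1%:Z.

Definition queens (n : nat) : rel (square n) := fun s t =>
  (s != t) &&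
  [|| sqrow s == sqrow t, sqcol s == sqcol t,
      sqrow s + sqcol s == sqrow t + sqcol t | sqrow s - sqcol s == sqrow t - sqcol t].

Lemma queens_irreflexive (n : nat) : irreflexive (@queens n).
Proof. by move=> s; rewrite /queens eqxx. Qed.

Lemma queens_symmetric (n : nat) : symmetric (@queens n).
Proof.
move=> s t; rewrite /queens eq_sym (eq_sym (sqrow s)) (eq_sym (sqcol s)).
by rewrite (eq_sym (sqrow s + sqcol s)) (eq_sym (sqrow s - sqcol s)).
Qed.

Definition ominus (n : nat) (s : square n) : int := `|sqrow s - sqcol s|.
Definition oplus (n : nat) (s : square n) : int :=
  `|sqrow s + sqcol s - (n%:Z + 1)|.

Section Vectors.
Variables (R : realFieldType) (n : nat) (lam : int).

Definition kcoef : R := (lam + 4)%:~R - (n%:R - 1) / 2.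

Definition Pcoord (s : square n) : R :=
  if ominus s == n%:Z - (lam + 4) then kcoef
  else if [&& ominus s < n%:Z - (lam + 4), oplus s < lam + 4
            & (ominus s == n%:Z - (lam + 4) %[mod 2])%Z] then 1
  else 0.

Definition Qcoord (s : square n) : R :=
  if oplus s == n%:Z - (lam + 4) then - kcoef
  else if [&& oplus s < n%:Z - (lam + 4), ominus s < lam + 4
            & (oplus s == n%:Z - (lam + 4) %[mod 2])%Z] then -1
  else 0.

Definition Pvec : 'cV[R]_#|square n| := vec_of Pcoord.
Definition Qvec : 'cV[R]_#|square n| := vec_of Qcoord.
Definition Evec : 'cV[R]_#|square n| := Pvec + Qvec.

End Vectors.

(* Main.v *)
Require Import Defs.
From mathcomp Require Import all_boot all_order all_algebra.
From mathcomp Require Import zify ring lra.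

(** Put m = lam + 4 and d = n - m, and let u = row - col and
    v = row + col - (n + 1) be the diagonal coordinates of a square.  Since n is
    odd, u and v have the same parity on the board, and |u| + |v| <= n - 1.

    In these coordinates the vector is an antisymmetrized product,
    E = sides |u| * band |v| - sides |v| * band |u|: the support of P is the
    rectangle |u| <= d, |v| <= m - 1 inscribed in the board, [band] is the
    indicator of its second factor, and [sides] carries the weight k on the two
    sides |u| = d and 1 in between, always on coordinates of the parity of d
    ([PcoordDQcoord]).

    A square attacks along four lines, each of which contains the square itself,
    so the adjacency matrix sends E to the sum of its four line sums minus 4 E
    ([sum_queens]), and the claim is that the line sums add up to m E.
    Reflecting the board swaps |u| and |v|, hence negates E; so E sums to 0 on
    each row and column, and its antidiagonal sums are the opposites of its
    diagonal sums.  The sum over a diagonal u is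
    m sides |u| - c band |u|, where m is the length of the rectangle in the
    direction v and c is the total weight of [sides]
    ([sum_profile_diagonal]).  The weight k is chosen so that c = m when d > 0
    ([sides_sumE]), and then the difference of the sums along the two diagonals
    through a square is m E there ([profile_balance]).

    E is nonzero because at the corner u = d, v = m - 1 of the rectangle it
    takes the value k, unless the rectangle is a square; the two excluded
    eigenvalues are k = 0 and d = m - 1 ([profile_neq0]). *)

Set Implicit Arguments.
Unset Strict Implicit.
Unset Printing Implicit Defensive.

Import Order.TTheory GRing.Theory Num.Theory.
Local Open Scope ring_scope.

(** * Line sums and the queens graph *)

Lemma square_eqE (n : nat) (s t : square n) :
  (s == t) = (sqrow s == sqrow t) && (sqcol s == sqcol t).
Proof. by case: s t => [i j] [p q]; rewrite xpair_eqE /sqrow /sqcol -!val_eqE. Qed.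

(** Two distinct squares share at most one line, whereas a square shares all
    four lines with itself; the last term removes that overcount. *)
Lemma queens_natr (R : nzRingType) (n : nat) (s t : square n) :
  (queens s t)%:R =
    (sqrow s == sqrow t)%:R + (sqcol s == sqcol t)%:R
    + (sqrow s + sqcol s == sqrow t + sqcol t)%:R
    + (sqrow s - sqcol s == sqrow t - sqcol t)%:R
    - 4 * (s == t)%:R :> R.
Proof.
rewrite /queens square_eqE -natrM -!natrD.
apply/eqP; rewrite eq_sym subr_eq -natrD eq_sym; apply/eqP; congr (_%:R).
lia.
Qed.

Lemma sum_queens (R : nzRingType) (n : nat) (f : square n -> R) (s : square n) :
  \sum_t (queens s t)%:R * f t =
    \sum_(t | sqrow s == sqrow t) f t + \sum_(t | sqcol s == sqcol t) f t
    + \sum_(t | sqrow s + sqcol s == sqrow t + sqcol t) f t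
    + \sum_(t | sqrow s - sqcol s == sqrow t - sqcol t) f t
    - 4 * f s.
Proof.
have -> : f s = \sum_(t | s == t) f t.
  by rewrite (big_pred1 s) // => t; rewrite /= eq_sym.
rewrite !(big_mkcond (fun t => _ == _)) mulr_sumr -!big_split -sumrB /=.
apply: eq_bigr => t _; rewrite queens_natr mulrBl !mulrDl -mulrA.
have ifE (b : bool) : b%:R * f t = if b then f t else 0.
  by case: b; rewrite ?mul1r ?mul0r.
by rewrite !ifE.
Qed.

Lemma mul_adjacency_vec_of (R : nzRingType) (T : finType) (e : rel T)
    (f : T -> R) :
  adjacency_mx R e *m vec_of f = vec_of (fun s => \sum_t (e s t)%:R * f t).
Proof.
apply/matrixP => a j; rewrite !mxE (reindex (@enum_val T T)) /=; last first.
  exact/onW_bij/enum_val_bij.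
by apply: eq_bigr => b _; rewrite !mxE.
Qed.

(** * Reflections and geometry of the board *)

Definition flip_row (n : nat) (s : square n) : square n := (rev_ord s.1, s.2).
Definition flip_col (n : nat) (s : square n) : square n := (s.1, rev_ord s.2).

Lemma flip_rowK (n : nat) : involutive (@flip_row n).
Proof. by case=> i j; rewrite /flip_row /= rev_ordK. Qed.

Lemma flip_colK (n : nat) : involutive (@flip_col n).
Proof. by case=> i j; rewrite /flip_col /= rev_ordK. Qed.

Lemma sqrow_flip_row (n : nat) (s : square n) :
  sqrow (flip_row s) = n%:Z + 1 - sqrow s.
Proof. by case: s => i j; rewrite /sqrow /=; have := ltn_ord i; lia. Qed.

Lemma sqcol_flip_col (n : nat) (s : square n) :
  sqcol (flip_col s) = n%:Z + 1 - sqcol s.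
Proof. by case: s => i j; rewrite /sqcol /=; have := ltn_ord j; lia. Qed.

Lemma ominus_flip_row (n : nat) (s : square n) : ominus (flip_row s) = oplus s.
Proof. by rewrite /ominus /oplus sqrow_flip_row /sqcol /=; lia. Qed.

Lemma oplus_flip_row (n : nat) (s : square n) : oplus (flip_row s) = ominus s.
Proof. by rewrite -ominus_flip_row flip_rowK. Qed.

Lemma ominus_flip_col (n : nat) (s : square n) : ominus (flip_col s) = oplus s.
Proof. by rewrite /ominus /oplus sqcol_flip_col /sqrow /=; lia. Qed.

Lemma oplus_flip_col (n : nat) (s : square n) : oplus (flip_col s) = ominus s.
Proof. by rewrite -ominus_flip_col flip_colK. Qed.

Lemma sum_antisym (R : realFieldType) (T : finType) (g : T -> T) (p : pred T)
    (f : T -> R) :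
    involutive g -> (forall t, p (g t) = p t) -> (forall t, f (g t) = - f t) ->
  \sum_(t | p t) f t = 0.
Proof.
move=> gK pg fg; suff: \sum_(t | p t) f t = - \sum_(t | p t) f t by lra.
rewrite {1}(reindex_inj (inv_inj gK)) -sumrN.
by apply: eq_big => [t | t _]; rewrite ?pg ?fg.
Qed.

Lemma sqrow_bounds (n : nat) (s : square n) : 1 <= sqrow s <= n%:Z.
Proof. by rewrite /sqrow; have := ltn_ord s.1; lia. Qed.

Lemma sqcol_bounds (n : nat) (s : square n) : 1 <= sqcol s <= n%:Z.
Proof. by rewrite /sqcol; have := ltn_ord s.2; lia. Qed.

(** The diagonal coordinates of a square fill a diamond of radius n - 1: this
    is what makes the two inscribed rectangles fit exactly. *)
Lemma ominusD_oplus_le (n : nat) (s : square n) : ominus s + oplus s <= n%:Z - 1.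
Proof.
by have := sqrow_bounds s; have := sqcol_bounds s; rewrite /ominus /oplus; lia.
Qed.

Lemma ominus_oplus_mod2 (n : nat) (s : square n) :
  odd n -> (ominus s == oplus s %[mod 2])%Z.
Proof. rewrite /ominus /oplus; lia. Qed.

Lemma square_of_coords (n : nat) (i j : int) :
    1 <= i <= n%:Z -> 1 <= j <= n%:Z ->
  exists s : square n, sqrow s = i /\ sqcol s = j.
Proof.
move=> i_bnd j_bnd.
have lt_i : (`|i|.-1 < n)%N by lia.
have lt_j : (`|j|.-1 < n)%N by lia.
by exists (Ordinal lt_i, Ordinal lt_j); rewrite /sqrow /sqcol /=; lia.
Qed.

(** On the diagonal u the antidiagonal coordinate runs by steps of 2 through
    an interval symmetric about 0.  When F, on the relevant parity, lives in
    [[-w, w]] and this window lies inside the board, the sum runs over the w + 1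
    points 2 r - w of the window. *)
Lemma sum_diagonal (R : realFieldType) (n w : nat) (u : int) (F : int -> R) :
    odd n -> `|u| + w%:Z <= n%:Z - 1 -> (`|u| == w%:Z %[mod 2])%Z ->
    (forall z, (z == w%:Z %[mod 2])%Z -> w%:Z < z -> F z = 0) ->
  \sum_(t : square n | u == sqrow t - sqcol t) F (oplus t) =
    \sum_(r < w.+1) F `|2 * r%:Z - w%:Z|.
Proof.
move=> odd_n uw par F0.
(* Split each term according to the point of the window that its square hits:
   every square of the window hits exactly one, and exchanging the sums leaves
   exactly one square for every point. *)
pose v (t : square n) := sqrow t + sqcol t - (n%:Z + 1).
transitivity (\sum_(t : square n | u == sqrow t - sqcol t)
    \sum_(r < w.+1) if v t == 2 * r%:Z - w%:Z then F `|2 * r%:Z - w%:Z| else 0).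
  apply: eq_bigr => t /eqP ut; rewrite -big_mkcond /=.
  have [le_w | gt_w] := lerP (oplus t) w%:Z; last first.
    rewrite F0 // ?big1 // => [r /eqP vt |].
      by move: gt_w (ltn_ord r); rewrite /oplus -/(v t) vt; lia.
    by have := ominus_oplus_mod2 t odd_n; rewrite /ominus; lia.
  have lt_r : (`|(v t + w%:Z) %/ 2|%Z < w.+1)%N.
    by move: le_w; rewrite /oplus -/(v t); lia.
  rewrite (big_pred1 (Ordinal lt_r)) => [|r /=].
    congr F; rewrite /oplus -/(v t) /=.
    have := ominus_oplus_mod2 t odd_n; rewrite /ominus /oplus -/(v t).
    by move: le_w; rewrite /oplus -/(v t); lia.
  rewrite -val_eqE /=.
  have := ominus_oplus_mod2 t odd_n; rewrite /ominus /oplus -/(v t).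
  by move: le_w; rewrite /oplus -/(v t); lia.
rewrite exchange_big; apply: eq_bigr => r _ /=.
(* Both halvings are exact: u and w have the same parity and n is odd. *)
have [||s [si sj]] := @square_of_coords n
    ((2 * r%:Z - w%:Z + u + n%:Z + 1) %/ 2)%Z
    ((2 * r%:Z - w%:Z - u + n%:Z + 1) %/ 2)%Z.
- by have := ltn_ord r; lia.
- by have := ltn_ord r; lia.
rewrite -big_mkcondr (big_pred1 s) // => t /=.
by rewrite square_eqE /v si sj; lia.
Qed.

(** * The eigenvector as an antisymmetrized product *)

Section Profiles.
Variables (R : realFieldType) (h m d : nat).
Hypotheses (mD : (m + d)%N = h.*2.+1) (m_gt0 : (0 < m)%N).
Notation n := (h.*2.+1).
Notation k := (m%:R - h%:R : R).

Definition sides (z : int) : R :=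
  if z == d%:Z then k
  else if (z < d%:Z) && (z == d%:Z %[mod 2])%Z then 1 else 0.

Definition band (z : int) : R := ((z < m%:Z) && (z == d%:Z %[mod 2])%Z)%:R.

Definition profile (s : square n) : R :=
  sides (ominus s) * band (oplus s) - sides (oplus s) * band (ominus s).

Lemma odd_side : odd n.
Proof. by rewrite /= odd_double. Qed.

Lemma sum_band : \sum_(r < m.-1.+1) band `|2 * r%:Z - (m.-1)%:Z| = m%:R.
Proof.
rewrite (eq_bigr (fun _ => 1)) => [|r _].
  by rewrite sumr_const card_ord prednK.
rewrite /band (_ : _ && _ = true) //.
by have := ltn_ord r; lia.
Qed.

Definition sides_sum : R := \sum_(r < d.+1) sides `|2 * r%:Z - d%:Z|.

(** Two sides of weight k and d - 1 interior points of weight 1 give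
    2 k + d - 1, which is m because k = m - h and m + d = 2 h + 1.  When d = 0
    the two sides coincide and the sum is only k. *)
Lemma sides_sumE : (0 < d)%N -> sides_sum = m%:R.
Proof.
move=> d_gt0.
rewrite /sides_sum -(big_mkord xpredT (fun r => sides `|2 * r%:Z - d%:Z|)).
rewrite big_nat_recr //= big_ltn //= (eq_big_nat _ _ (F2 := fun _ => 1)) => [|r r_bnd].
  rewrite sumr_const_nat /sides !ifT; try lia.
  have : m%:R + (d - 1)%:R = h%:R * 2 :> R.
    by rewrite -natrD -natrM; congr _%:R; lia.
  by lra.
by rewrite /sides ifF ?ifT //; lia.
Qed.

(** On a diagonal meeting the rectangle of P, the window |v| <= m - 1 of [band]
    lies on the board; on one meeting the rectangle of Q, so does the window
    |v| <= d of [sides].  On any other diagonal the factor in |u| vanishes. *)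
Lemma sum_profile_diagonal (u : int) :
  \sum_(t : square n | u == sqrow t - sqcol t) profile t =
    m%:R * sides `|u| - sides_sum * band `|u|.
Proof.
transitivity (sides `|u| * \sum_(t : square n | u == sqrow t - sqcol t) band (oplus t)
  - band `|u| * \sum_(t : square n | u == sqrow t - sqcol t) sides (oplus t)).
  rewrite !mulr_sumr -sumrB; apply: eq_bigr => t /eqP ->.
  by rewrite /profile /ominus [band _ * _]mulrC.
congr (_ - _).
  rewrite /sides; case: ifP => [u_d | uNd]; last case: ifP => [u_lt | _]; last first.
  - by rewrite mul0r mulr0.
  - rewrite (@sum_diagonal _ _ m.-1 _ band) ?sum_band ?odd_side 1?mulrC //; try lia.
    by move=> z z_par z_gt; rewrite /band (_ : _ && _ = false) //; lia.
  - rewrite (@sum_diagonal _ _ m.-1 _ band) ?sum_band ?odd_side 1?mulrC //; try lia.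
    by move=> z z_par z_gt; rewrite /band (_ : _ && _ = false) //; lia.
rewrite /band; case: (boolP (_ && _)) => [u_lt | _]; last by rewrite mul0r mulr0.
rewrite (@sum_diagonal _ _ d _ sides) ?odd_side 1?mulrC //; try lia.
by move=> z z_par z_gt; rewrite /sides !ifF //; lia.
Qed.

Lemma profile_flip_row (s : square n) : profile (flip_row s) = - profile s.
Proof. by rewrite /profile ominus_flip_row oplus_flip_row opprB. Qed.

Lemma profile_flip_col (s : square n) : profile (flip_col s) = - profile s.
Proof. by rewrite /profile ominus_flip_col oplus_flip_col opprB. Qed.

(** A reflection turns the antidiagonal into a diagonal and negates the terms. *)
Lemma sum_profile_antidiagonal (s : square n) :
  \sum_(t : square n | sqrow s + sqcol s == sqrow t + sqcol t) profile t =
    - (m%:R * sides (oplus s) - sides_sum * band (oplus s)).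
Proof.
rewrite -sum_profile_diagonal [LHS](reindex_inj (inv_inj (@flip_colK n))) -sumrN /=.
apply: eq_big => [t | t _]; last exact: profile_flip_col.
by rewrite sqcol_flip_col /sqrow /=; lia.
Qed.

(** Off the parity of d both sides vanish.  On it, for d > 0 one divides by m:
    since p + q <= d + m - 1, p > d forces q < m and p >= m forces q < d, and
    the few configurations this leaves are immediate.  For d = 0 the constant
    [sides_sum] differs from m, but [band] then covers the whole board, so its
    two occurrences cancel. *)
Lemma profile_balance (p q : int) :
    0 <= p -> 0 <= q -> p + q <= n%:Z - 1 -> (p == q %[mod 2])%Z ->
  (m%:R * sides p - sides_sum * band p) - (m%:R * sides q - sides_sum * band q)
    = m%:R * (sides p * band q - sides q * band p).
Proof.
move=> p0 q0 pq par.
have [d0 | d_gt0] := posnP d.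
  have pm : p < m%:Z by lia.
  have qm : q < m%:Z by lia.
  have parE : (q == d%:Z %[mod 2])%Z = (p == d%:Z %[mod 2])%Z by lia.
  rewrite /band pm qm /= parE.
  have [par_p | par_p] := boolP (p == d%:Z %[mod 2])%Z.
    by rewrite !mulr1; ring.
  rewrite /sides !ifF; try lia.
  by rewrite /=; ring.
rewrite sides_sumE // -!mulrBr; congr (_ * _); rewrite /sides /band.
case: (eqVneq p d%:Z) => p_d; case: (eqVneq q d%:Z) => q_d;
case: (boolP ((p < d%:Z) && (p == d%:Z %[mod 2])%Z)) => pd;
case: (boolP ((q < d%:Z) && (q == d%:Z %[mod 2])%Z)) => qd;
case: (boolP ((p < m%:Z) && (p == d%:Z %[mod 2])%Z)) => pm;
case: (boolP ((q < m%:Z) && (q == d%:Z %[mod 2])%Z)) => qm;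
  by try (exfalso; lia); rewrite /=; ring.
Qed.

Lemma sum_queens_profile (s : square n) :
  \sum_t (queens s t)%:R * profile t = (m%:R - 4) * profile s.
Proof.
rewrite sum_queens (sum_antisym (@flip_colK n) _ profile_flip_col) //.
rewrite (sum_antisym (@flip_rowK n) _ profile_flip_row) //.
rewrite sum_profile_antidiagonal sum_profile_diagonal -/(ominus s) !add0r addrC.
rewrite addrC [X in X - _]addrC profile_balance ?mulrBl //.
  exact: ominusD_oplus_le.
exact/ominus_oplus_mod2/odd_side.
Qed.

(** The two exclusions on m say that k <> 0 and that d <> m - 1. *)
Lemma profile_neq0 : m != h -> m != h.+1 -> exists s : square n, profile s != 0.
Proof.
move=> mNh mNh1; have [||s [si sj]] := @square_of_coords n n%:Z m%:Z; try lia.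
(* The square in the last row and column m is the corner u = d, v = m - 1. *)
have om : ominus s = d%:Z by rewrite /ominus si sj; lia.
have op : oplus s = (m.-1)%:Z by rewrite /oplus si sj; lia.
exists s; rewrite /profile om op.
have -> : band (m.-1)%:Z = 1 by rewrite /band (_ : _ && _ = true) //; lia.
have -> : sides (m.-1)%:Z * band d%:Z = 0.
  have [lt_dm | le_md] := ltnP d m.
    by rewrite /sides !ifF ?mul0r //; lia.
  by rewrite /band (_ : _ && _ = false) ?mulr0 //; lia.
by rewrite /sides eqxx mulr1 subr0 subr_eq0 eqr_nat.
Qed.

(** On the outer sides p = d of the rectangle the constraint q < m is implied by
    the board, which is why the definition of P does not impose it there. *)
Lemma sides_mul_band (p q : int) :
    p + q <= n%:Z - 1 -> (p == q %[mod 2])%Z ->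
  sides p * band q =
    if p == d%:Z then k
    else if [&& p < d%:Z, q < m%:Z & (p == d%:Z %[mod 2])%Z] then 1 else 0.
Proof.
move=> pq par; rewrite /sides /band.
have -> : (q == d%:Z %[mod 2])%Z = (p == d%:Z %[mod 2])%Z by lia.
have [pE | _] := eqVneq p d%:Z.
  by rewrite (_ : _ && _ = true) ?mulr1 //; lia.
case: (p < d%:Z); last by rewrite mul0r.
case: (q < m%:Z); last by rewrite mulr0.
by case: (p == d%:Z %[mod 2])%Z; rewrite ?mulr1 ?mul0r.
Qed.

Lemma PcoordDQcoord (lam : int) (s : square n) :
  lam + 4 = m%:Z -> Pcoord R lam s + Qcoord R lam s = profile s.
Proof.
move=> lamE; have sum_le := ominusD_oplus_le s.
have par := ominus_oplus_mod2 s odd_side.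
have kE : kcoef R n lam = k.
  by rewrite /kcoef lamE -pmulrn -natr1 -muln2 natrM; lra.
rewrite /Pcoord /Qcoord /profile kE lamE !sides_mul_band //; try lia.
rewrite (_ : n%:Z - m%:Z = d%:Z); last by lia.
by congr (_ + _); do 2?case: ifP; rewrite ?oppr0.
Qed.
End Profiles.

(** * The eigenvalue equation *)

(* [%/] below is integer division in [int], exact here because n is odd. *)
Theorem corollary3p2 (R : realFieldType) (n : nat) (lam : int)
    (n_ge4 : (4 <= n)%N) (n_odd : odd n)
    (lam_range : (-3 <= lam <= ((n%:Z - 11) %/ 2)%Z) \/
                 (((n%:Z - 5) %/ 2)%Z <= lam <= n%:Z - 4)) :
  is_eigenvector (adjacency_mx R (@queens n)) lam%:~R (Evec R n lam).
Proof.
pose h := n./2; pose m := absz (lam + 4); pose d := (n - m)%N.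
have nE : n = h.*2.+1 by lia.
have lamE : lam + 4 = m%:Z by lia.
have m_gt0 : (0 < m)%N by lia.
have mD : (m + d)%N = h.*2.+1 by lia.
have mNh : m != h by lia.
have mNh1 : m != h.+1 by lia.
clearbody h m d; subst n.
have lamR : lam%:~R = m%:R - 4 :> R.
  by rewrite -[lam](addrK 4) lamE rmorphB.
have EE : Evec R h.*2.+1 lam = vec_of (@profile R h m d).
  by apply/matrixP => a j; rewrite !mxE (PcoordDQcoord _ mD m_gt0).
split.
  have [s] := profile_neq0 R mD m_gt0 mNh mNh1.
  apply: contra_neq => E0; have /matrixP/(_ (enum_rank s) 0) := E0.
  by rewrite EE !mxE enum_rankK.
rewrite EE mul_adjacency_vec_of; apply/matrixP => a j.
by rewrite !mxE sum_queens_profile // lamR.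
Qed.
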